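(* Let $\Gamma$ be a countable group and $\Lambda$ a co-amenable subgroup of $\Gamma$. Let $\Gamma\curvearrowright(X,\mu)$ be a probability measure preserving action on a standard probability space. Then $\Gamma\curvearrowright (X,\mu)$ has the property (T) relative to the space if and only if the restricted action $\Lambda\curvearrowright (X,\mu)$ has the property (T) relative to the space.
   Context: A subgroup $\Lambda$ of a countable group $\Gamma$ is co-amenable if there exists a sequence $f_n\in \ell^1(\Gamma/\Lambda)$ with $f_n\ge 0$, $\|f_n\|_1=1$, and $\|\pi(\gamma)f_n-f_n\|_1\to 0$ as $n\to\infty$ for all $\gamma\in\Gamma$, where $\pi(\gamma)f_n(x)=f_n(\gamma^{-1}x)$ for $x\in\Gamma/\Lambda$. A probability measure preserving action $\Gamma\curvearrowright(X,\mu)$ of a countable group $\Gamma$ on a standard probability space has the property (T) relative to the space (is rigid) if for every sequence $(\nu_n)$ of Borel probability measures on $X\times X$ satisfying (1) $p^i_*\nu_n=\mu$ for all $n$ and $i=1,2$, where $p^i:X\times X\to X$ is the projection onto the $i$-th coordinate; (2) $\int_{X\times X}\varphi(x)\psi(y)\,d\nu_n(x,y)\to\int_X\varphi(x)\psi(x)\,d\mu(x)$ as $n\to\infty$ for all bounded Borel functions $\varphi,\psi:X\to\mathbb{C}$; (3) $\|(\gamma\times\gamma)_*\nu_n-\nu_n\|\to 0$ as $n\to\infty$ (total variation norm) for every $\gamma\in\Gamma$; one has $\nu_n(\Delta_X)\to 1$, where $\Delta_X=\{(x,x):x\in X\}$. *)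

(* Defs.v *)
From HB Require Import structures.
From mathcomp Require Import all_boot all_order all_algebra.
From mathcomp Require Import all_classical all_reals all_analysis.
From mathcomp Require Import complex.

Set Implicit Arguments.
Unset Strict Implicit.
Unset Printing Implicit Defensive.

Import Order.TTheory GRing.Theory Num.Theory.
Import numFieldTopology.Exports numFieldNormedType.Exports.

Local Open Scope classical_set_scope.
Local Open Scope ring_scope.
Local Open Scope complex_scope.

(* The sigma-algebra of X is the Borel sigma-algebra of a Polish topology: X is
   identified through f with a complete, separated, second countable
   pseudometric space. *)
Definition standard_borel (R : realType) d (X : measurableType d) : Prop :=
  exists (Y : completePseudoMetricType R) (f : X -> Y),
    [/\ hausdorff_space Y, @second_countable Y, bijective f
      & forall A : set Y, <<s open >> A <-> measurable (f @^-1` A)].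

Section Coamenable.
Context (G : groupType) (P : pred G) (L : subGroupType P).
Local Open Scope group_scope.

Definition translate (g : G) (C : set G) : set G := [set g * x | x in C].

(* G / L, as the set of the left cosets gL *)
Definition left_cosets : set (set G) :=
  range (fun g : G => translate g (range (val : L -> G))).

(* pi(g) f (x) = f (g^-1 x); only the values on left_cosets matter, and
   left_cosets is stable under translation. *)
Definition quasi_regular (R : realType) (g : G) (f : set G -> R) : set G -> R :=
  fun C => f (translate g^-1 C).

Definition l1norm (R : realType) (T : choiceType) (D : set T) (f : T -> R) :
    \bar R :=
  (\esum_(x in D) `|(f x)%:E|)%E.

Definition coamenable (R : realType) : Prop :=
  exists f : (set G -> R)^nat,
    [/\ forall n, summable left_cosets (EFin \o f n),
        forall n C, left_cosets C -> (0 <= f n C)%R,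
        forall n, l1norm left_cosets (f n) = 1%E
      & forall g : G,
          l1norm left_cosets (quasi_regular g (f n) \- f n)%R @[n --> \oo]
            --> 0%E].

End Coamenable.
Arguments coamenable {G P} L R.

Section PmpAction.
Context (R : realType) d (X : measurableType d) (mu : probability X R).

Record pmp_action (G : groupType) := PmpAction {
  act :> G -> {mfun X >-> X};
  act1 : forall x, act 1%g x = x;
  actM : forall g h x, act (g * h)%g x = act g (act h x);
  act_preserves : forall g A, measurable A -> mu (act g @^-1` A) = mu A
}.

Section Restrict.
Context (G : groupType) (P : pred G) (L : subGroupType P) (a : pmp_action G).

Let ract (l : L) : {mfun X >-> X} := a (val l).

Let ract1 x : ract 1%g x = x.
Proof. by rewrite /ract val1 act1. Qed.

Let ractM g h x : ract (g * h)%g x = ract g (ract h x).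
Proof. by rewrite /ract valM actM. Qed.

Let ract_preserves g A : measurable A -> mu (ract g @^-1` A) = mu A.
Proof. exact: act_preserves. Qed.

Definition restrict_action : pmp_action L := PmpAction ract1 ractM ract_preserves.

End Restrict.
End PmpAction.
Arguments restrict_action {R d X mu G P} L a.

Section ProductMap.
Context d (X : measurableType d) (f : {mfun X >-> X}).

Definition product_map (p : X * X) : X * X := (f p.1, f p.2).

Let product_map_measurable : measurable_fun setT product_map.
Proof. by apply: measurable_fun_pair => /=; apply: measurableT_comp. Qed.

HB.instance Definition _ :=
  isMeasurableFun.Build _ _ _ _ product_map product_map_measurable.

End ProductMap.

Section TotalVariation.
Context (R : realType) d (T : measurableType d).

(* |nu|(T), for a chosen Hahn decomposition; the value does not depend on the
   choice (Hahn_decomposition_uniq). *)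
Definition total_variation_norm (nu : {charge set T -> \bar R}) : \bar R :=
  charge_variation (svalP (cid (svalP (cid (Hahn_decomposition nu))))) [set: T].

Definition measure_diff (m1 m2 : {finite_measure set T -> \bar R}) :
    {charge set T -> \bar R} :=
  cadd (charge_of_finite_measure m1) (copp (charge_of_finite_measure m2)).

End TotalVariation.

Section ComplexIntegral.
Context (R : realType) d (T : measurableType d).

(* R[i]^o is R[i] with the topology of its norm. *)
Definition borel_complex (f : T -> R[i]^o) : Prop :=
  forall U : set R[i]^o, open U -> measurable (f @^-1` U).

Definition bounded_complex (f : T -> R[i]^o) : Prop :=
  exists M : R, forall x, `|f x| <= M%:C.

Definition Cintegral (m : {measure set T -> \bar R}) (f : T -> R[i]^o) : R[i]^o :=
  (\int[m]_x complex.Re (f x)) +i* (\int[m]_x complex.Im (f x)).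

End ComplexIntegral.

Definition rigid (R : realType) d (X : measurableType d) (mu : probability X R)
    (G : groupType) (a : pmp_action mu G) : Prop :=
  forall nu : (probability (X * X)%type R)^nat,
    (forall n A, measurable A ->
       pushforward (nu n) fst A = mu A /\ pushforward (nu n) snd A = mu A) ->
    (forall phi psi : X -> R[i]^o,
       borel_complex phi -> bounded_complex phi ->
       borel_complex psi -> bounded_complex psi ->
       Cintegral (nu n) (fun p => phi p.1 * psi p.2) @[n --> \oo]
         --> Cintegral mu (fun x => phi x * psi x)) ->
    (forall g : G,
       total_variation_norm
         (measure_diff (distribution (nu n) (product_map (a g))) (nu n))
         @[n --> \oo] --> 0%E) ->
    nu n [set p | p.1 = p.2] @[n --> \oo] --> 1%E.

(* Main.v *)
Require Import Defs.
From mathcomp Require Import all_boot all_order all_algebra.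
From mathcomp Require Import all_classical all_reals all_analysis.
From mathcomp Require Import complex measurable_realfun ring lra.
Set Implicit Arguments.
Unset Strict Implicit.
Unset Printing Implicit Defensive.
Import Order.TTheory GRing.Theory Num.Theory.
Import numFieldTopology.Exports numFieldNormedType.Exports.
Local Open Scope classical_set_scope.
Local Open Scope ring_scope.

(** Rigidity speaks of the sequences of self-couplings of mu that concentrate
    near the diagonal and are almost invariant.  Almost invariance under G
    implies almost invariance under L, so rigidity passes from L to G.

    Conversely, let nu_n be such a sequence for L.  For a probability f on
    G / L with finite support, replace nu_n by its average
    sum_C f(C) (g_C, g_C)_* nu_n, where g_C represents the coset C.  As nu_n is
    almost L-invariant, the choice of the representatives hardly matters, so
    translating the average by g has the same effect as translating f
    [near_average_invariant]; co-amenability provides f that hardly move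
    [folner_weights_exist].  The maps x |-> g x are bijections that preserve mu,
    so the average is still a self-coupling of mu and gives the diagonal the
    same mass as nu_n does [average_self_coupling, average_diagonal].  Once the
    averages satisfy the hypotheses of rigidity for G, rigidity for G yields
    the conclusion for nu_n itself.

    A fixed f only makes the averages invariant up to a fixed error, so f has
    to improve with n, slowly enough for nu_n to be already almost invariant and
    concentrated at the scale of f.  Such a diagonal choice [diagonal_choice]
    handles countably many requirements, whereas concentration is required
    against all bounded Borel functions.  For self-couplings of mu it is however
    equivalent to nu_n (A `*` ~` A) -> 0 for every measurable A
    [cvg_Cintegral_offdiag, offdiag_null_cvg_Cintegral], and the sets A with this
    property form a sigma-algebra [offdiag_null_sigma_algebra].  It is therefore
    enough to control the sets of a countable generating family, which a standard
    Borel space has [standard_borel_generators]. *)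

(** * Sequences that are eventually small, and diagonal choices *)

Lemma near_all_seq (T : eqType) (s : seq T) (Q : T -> nat -> Prop) :
  (forall x, x \in s -> \forall n \near \oo, Q x n) ->
  \forall n \near \oo, forall x, x \in s -> Q x n.
Proof.
elim: s => [|y s IH] Qs; first by near=> n.
have Qy := Qs y (mem_head y s).
have {}IH : \forall n \near \oo, forall x, x \in s -> Q x n.
  by apply: IH => x xs; apply: Qs; rewrite inE xs orbT.
near=> n => x; rewrite inE => /predU1P[->|xs]; first by near: n.
by move: x xs; near: n.
Unshelve. all: by end_near. Qed.

Lemma countable_enum (T : choiceType) (A : set T) (x0 : T) : countable A ->
  exists u : nat -> T, forall x, A x -> exists k, u k = x.
Proof.
move=> /countable_injP[f finj].
exists (fun k => xget x0 [set x | A x /\ f x = k]) => x Ax.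
exists (f x); case: xgetP => [y _ [Ay /esym fxy]|/(_ x)/=]; last by case.
by apply/esym/finj; rewrite ?inE.
Qed.

(** Each condition Q k holds from some rank M k on; kappa n is the largest
    k <= n whose rank has been reached by n. *)
Lemma diagonal_choice (Q : nat -> nat -> Prop) :
  (forall k, \forall n \near \oo, Q k n) ->
  exists kappa : nat -> nat,
    forall k, \forall n \near \oo, (k <= kappa n)%N /\ Q (kappa n) n.
Proof.
move=> nearQ.
have [M MQ] : {M : nat -> nat | forall k n, (M k <= n)%N -> Q k n}.
  suff M k : {Mk | forall n, (Mk <= n)%N -> Q k n}.
    by exists (fun k => sval (M k)) => k; exact: (svalP (M k)).
  by apply: cid; have [Mk _ MkQ] := nearQ k; exists Mk.
exists (fun n => \max_(k < n.+1 | (M k <= n)%N) k) => k.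
near=> n.
have Mkn : (M k <= n)%N by near: n; exists (M k).
have kn : (k < n.+1)%N by rewrite ltnS; near: n; exists k.
split.
  exact: (@leq_bigmax_cond _ (fun i : 'I_n.+1 => (M i <= n)%N)
    (fun i : 'I_n.+1 => i : nat) (Ordinal kn)).
have [i Min ->] : {i : 'I_n.+1 | (M i <= n)%N &
    \max_(k < n.+1 | (M k <= n)%N) k = i :> nat}.
  by apply: eq_bigmax_cond; apply/card_gt0P; exists (Ordinal kn).
exact: MQ.
Unshelve. all: by end_near. Qed.

Section Vanishes.
Context (R : realType).
Local Open Scope ereal_scope.

(** For nonnegative u this is convergence to 0.  The one-sided form is stable
    under domination and finite sums without finiteness side conditions. *)
Definition vanishes (u : nat -> \bar R) : Prop :=
  forall e : R, (0 < e)%R -> \forall n \near \oo, u n <= e%:E.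

Lemma vanishes_sum (N : nat) (u : nat -> nat -> \bar R) :
  (forall i, vanishes (u i)) -> vanishes (fun n => \sum_(i < N) u i n).
Proof.
move=> u0; elim: N => [|N IH] e e0.
  by near=> n; rewrite big_ord0 lee_fin ltW.
have e20 : (0 < e / 2)%R by rewrite divr_gt0.
near=> n; rewrite big_ord_recr/= (splitr e) EFinD; apply: leeD.
  by near: n; exact: IH.
by near: n; exact: u0.
Unshelve. all: by end_near. Qed.

Lemma le_vanishes (u v : nat -> \bar R) :
  (forall n, u n <= v n) -> vanishes v -> vanishes u.
Proof.
move=> uv v0 e e0; near=> n; apply: (le_trans (uv n)).
by near: n; exact: v0.
Unshelve. all: by end_near. Qed.

Lemma cvg0_vanishes (u : nat -> \bar R) : u @ \oo --> 0 -> vanishes u.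
Proof.
move=> /fine_cvgP[ufin /cvgrPdist_le u0] e e0; near=> n.
have un_fin : u n \is a fin_num by near: n.
rewrite -(fineK un_fin) lee_fin; apply: (le_trans (ler_norm _)).
have : (`|0 - fine (u n)| <= e)%R by near: n; exact: u0.
by rewrite sub0r normrN.
Unshelve. all: by end_near. Qed.

Lemma vanishes_cvg0 (u : nat -> \bar R) :
  (forall n, 0 <= u n) -> vanishes u -> u @ \oo --> 0.
Proof.
move=> u_ge0 u0.
have fin n (e : R) : u n <= e%:E -> u n \is a fin_num.
  by move=> une; rewrite ge0_fin_numE// (le_lt_trans une)// ltry.
apply/fine_cvgP; split.
  by have := u0 1%R ltr01; apply: filterS => n; exact: fin.
apply/cvgrPdist_le => e e0; have := u0 e e0; apply: filterS => n une.
by rewrite sub0r normrN ger0_norm ?fine_ge0// -lee_fin fineK// (fin _ e).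
Qed.

End Vanishes.

(** * Finitely supported almost invariant weights *)

Section SeqSums.
Context (R : realType) (T : choiceType).

Lemma sum_seq_le_esum (D : set T) (f : T -> R) (s : seq T) :
  uniq s -> {in s, forall x, D x} ->
  ((\sum_(x <- s) `|f x|)%:E <= \esum_(x in D) `|(f x)%:E|)%E.
Proof.
move=> us sD; apply: esum_ge; exists [set` s].
  by split; [exact: finite_seq|move=> x /=; exact: sD].
by rewrite -fsbig_seq// -sumEFin.
Qed.

Lemma esum_gt_sum_seq (D : set T) (f : T -> R) (r : R) :
  (r%:E < \esum_(x in D) `|(f x)%:E|)%E ->
  exists s : seq T, [/\ uniq s, {in s, forall x, D x} & r < \sum_(x <- s) `|f x|].
Proof.
move=> /ereal_sup_gt[_ [A [finA AD] <-]] rA.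
have /finite_seqP[t tA] := finA; move: rA; rewrite tA => rt.
exists (undup t); split; first exact: undup_uniq.
  by move=> x; rewrite mem_undup => xt; apply: AD; rewrite tA.
rewrite -lte_fin -sumEFin; apply: lt_le_trans rt _.
rewrite (_ : [set` t] = [set` undup t]) -?fsbig_seq ?undup_uniq//.
by apply/seteqP; split=> x /=; rewrite mem_undup.
Qed.

(** The part of t inside s contributes at most the sum over s. *)
Lemma ler_sum_seq_overlap (w : T -> R) (s t : seq T) :
  (forall x, 0 <= w x) -> uniq s -> uniq t ->
  \sum_(x <- t) w x <= \sum_(x <- s) w x + \sum_(x <- t | x \notin s) w x.
Proof.
move=> w0 us ut; rewrite (bigID (mem s))/= lerD2r.
rewrite -big_filter (perm_big [seq x <- s | x \in t]) /=.
  rewrite big_filter [leRHS](bigID (mem t))/= lerDl.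
  by apply: sumr_ge0.
apply: uniq_perm; rewrite ?filter_uniq// => x.
by rewrite !mem_filter andbC.
Qed.

End SeqSums.

Section Folner.
Context (R : realType) (G : groupType) (P : pred G) (L : subGroupType P).
Local Notation coset g := (translate g (range (val : L -> G))).

Lemma translateM (g h : G) C : translate (g * h)%g C = translate g (translate h C).
Proof.
rewrite /translate image_comp; congr (_ @` _).
by apply: funext => x /=; rewrite mulgA.
Qed.

Lemma translate1 (C : set G) : translate 1%g C = C.
Proof.
rewrite /translate; under eq_imagel do rewrite mul1g.
by rewrite image_id.
Qed.

Lemma translateK (g : G) : cancel (translate g) (translate g^-1).
Proof. by move=> C; rewrite -translateM mulVg translate1. Qed.

Lemma left_cosets_translate (g : G) C : left_cosets L C -> left_cosets L (translate g C).
Proof. by move=> [h _ <-]; exists (g * h)%g => //; rewrite translateM. Qed.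

(** Both the bound 1 and the almost invariance of an l^1 function are bounds on
    all its finite partial sums, so that only finite sums of reals appear from
    here on; s carries all but e of the mass. *)
Lemma almost_invariant_finite (S : seq G) (e : R) : coamenable L R -> 0 < e ->
  exists (f : set G -> R) (s : seq (set G)),
    [/\ uniq s, {in s, forall C, left_cosets L C},
        forall t, uniq t -> {in t, forall C, left_cosets L C} ->
          \sum_(C <- t) `|f C| <= 1,
        1 - e < \sum_(C <- s) `|f C|
     & forall t g, g \in S -> uniq t -> {in t, forall C, left_cosets L C} ->
          \sum_(C <- t) `|f (translate g^-1 C) - f C| <= e].
Proof.
move=> [f [_ _ f1 finv]] e0.
have : \forall n \near \oo, forall g, g \in S ->
   (l1norm (left_cosets L) (quasi_regular g (f n) \- f n)%R <= e%:E)%E.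
  by apply: near_all_seq => g _; exact: cvg0_vanishes (finv g) _ e0.
move=> [n _ /(_ n (leqnn n)) nP].
have [s [us sD sf]] : exists s : seq (set G), [/\ uniq s,
    {in s, forall x, left_cosets L x} & 1 - e < \sum_(x <- s) `|f n x|].
  apply: esum_gt_sum_seq; have := f1 n; rewrite /l1norm => ->.
  by rewrite lte_fin; lra.
exists (f n), s; split => //.
  by move=> t ut tD; rewrite -lee_fin -(f1 n); exact: sum_seq_le_esum.
move=> t g gS ut tD; rewrite -lee_fin; apply: le_trans (nP _ gS).
exact: (sum_seq_le_esum (fun C => quasi_regular g (f n) C - f n C)).
Qed.

(** Weak form of almost invariance of the measure sum_i c_i delta_(s_i L) on
    G / L under S.  The one-sided bound suffices: applied to 1 - u it gives the
    opposite one.  The points are recorded by elements s_i of G rather than by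
    cosets, since it is these elements that will act. *)
Definition folner_weights (S : seq G) (e : R) (N : nat)
    (c : nat -> {nonneg R}) (s : nat -> G) : Prop :=
  \sum_(i < N) (c i)%:num = 1 /\
  forall g (u : set G -> R), g \in S -> (forall C, 0 <= u C <= 1) ->
    \sum_(i < N) (c i)%:num * u (coset (g * s i)%g)
      <= \sum_(i < N) (c i)%:num * u (coset (s i)) + e.

(** The weights are |f| on a finite set s of cosets carrying most of its mass.
    The missing mass r <= e / 3 is put on the coset of 1; moving from the
    translate of s back to s costs e / 3 for the almost invariance of f and at
    most r for the mass of the translate that lies outside s. *)
Lemma folner_weights_exist (S : seq G) (e : R) : coamenable L R -> 0 < e ->
  exists N c s, folner_weights S e N c s.
Proof.
move=> Lco e0.
have [|f [s [us sD f1 sf finv]]] := almost_invariant_finite S Lco (e := e / 3).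
  by lra.
have [sec secE] : {sec : set G -> G | forall C, left_cosets L C -> coset (sec C) = C}.
  exists (fun C => xget 1%g [set g | coset g = C]) => C [g _ gC].
  by case: xgetP => // /(_ g); rewrite /= gC.
pose r := 1 - \sum_(C <- s) `|f C|.
exists (size s).+1.
exists (fun i => if (i < size s)%N then (`|f (nth set0 s i)|)%:nng else `|r|%:nng).
exists (fun i => if (i < size s)%N then sec (nth set0 s i) else 1%g).
(* the index size s is the one of the remaining mass r *)
have split_sum (h : {nonneg R} -> G -> R) : \sum_(i < (size s).+1)
    h (if (i < size s)%N then (`|f (nth set0 s i)|)%:nng else `|r|%:nng)
      (if (i < size s)%N then sec (nth set0 s i) else 1%g)
   = \sum_(C <- s) h (`|f C|%:nng) (sec C) + h `|r|%:nng 1%g.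
  rewrite big_ord_recr/= ltnn; congr (_ + _).
  by rewrite (big_nth set0) big_mkord; apply: eq_bigr => i _; rewrite ltn_ord.
have r0 : 0 <= r by rewrite subr_ge0; exact: f1.
have re : r <= e / 3 by rewrite /r; lra.
split.
  by rewrite (split_sum (fun a _ => a%:num))/= ger0_norm// /r addrC subrK.
move=> g u gS u01.
rewrite (split_sum (fun a h => a%:num * u (coset (g * h)%g))).
rewrite (split_sum (fun a h => a%:num * u (coset h)))/= (ger0_norm r0).
have u0 C : 0 <= u C by case/andP: (u01 C).
have u1 C : u C <= 1 by case/andP: (u01 C).
have tg : {in s, forall C, coset (g * sec C)%g = translate g C}.
  by move=> C Cs; rewrite translateM secE//; exact: sD.
rewrite (eq_big_seq (fun C => `|f C| * u (translate g C))); last first.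
  by move=> C Cs; rewrite tg.
rewrite [X in _ <= X + _ + _](eq_big_seq (fun C => `|f C| * u C)); last first.
  by move=> C Cs; rewrite secE//; exact: sD.
pose t := map (translate g) s.
have ut : uniq t by rewrite map_inj_uniq//; exact: can_inj (@translateK g).
have tD : {in t, forall C, left_cosets L C}.
  by move=> _ /mapP[C /sD CD ->]; exact: left_cosets_translate.
have translate_le : \sum_(C <- s) `|f C| * u (translate g C)
    <= \sum_(C <- t) `|f C| * u C + e / 3.
  apply: le_trans (lerD (lexx _) (finv t g gS ut tD)).
  rewrite !big_map -big_split /= ler_sum// => C _.
  rewrite translateK; have := ler_distD (f (translate g C)) (f C) 0.
  rewrite !subr0 => /(ler_wpM2r (u0 (translate g C))) /le_trans; apply.
  by rewrite mulrDl [leRHS]addrC lerD2r ler_piMr.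
have overlap_le : \sum_(C <- t) `|f C| * u C <= \sum_(C <- s) `|f C| * u C + r.
  apply: le_trans (ler_sum_seq_overlap (w := fun C => `|f C| * u C) _ us ut) _.
    by move=> C; rewrite mulr_ge0.
  rewrite /= lerD2l lerBrDl; apply: le_trans (f1 (s ++ [seq C <- t | C \notin s]) _ _).
  - rewrite big_cat/= lerD2l big_filter ler_sum// => C _.
    by rewrite ler_piMr.
  - rewrite cat_uniq us filter_uniq// andbT/= -all_predC.
    by apply/allP => C; rewrite mem_filter => /andP[].
  - move=> C; rewrite mem_cat => /orP[/sD//|].
    by rewrite mem_filter => /andP[_ /tD].
have := ler_piMr r0 (u1 (coset (g * 1)%g)).
have := mulr_ge0 r0 (u0 (coset 1%g)).
lra.
Qed.

End Folner.

(** * Total variation and bounded integrands *)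

Section TotalVariation.
Context (R : realType) d (T : measurableType d).
Local Open Scope ereal_scope.
Implicit Types m : {finite_measure set T -> \bar R}.

Lemma measure_diffE m m' A : measure_diff m m' A = m A - m' A.
Proof. by rewrite /measure_diff/= /cadd/=. Qed.

Lemma le_total_variation_norm m m' A : measurable A ->
  `|m A - m' A| <= total_variation_norm (measure_diff m m').
Proof.
move=> mA; rewrite -measure_diffE /total_variation_norm.
set hahn := (X in charge_variation X _).
apply: (le_trans (abse_charge_variation hahn mA)).
by apply: le_measure; rewrite ?inE//.
Qed.

(** The two halves of a Hahn decomposition are themselves test sets, whence
    the factor 2. *)
Lemma total_variation_norm_le m m' (e : R) :
  (forall A, measurable A -> `|m A - m' A| <= e%:E) ->
  total_variation_norm (measure_diff m m') <= (e + e)%:E.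
Proof.
move=> dist_le; rewrite /total_variation_norm.
set hahn := (X in charge_variation X _); have [[mP _] [mN _] _ _] := hahn.
rewrite /charge_variation EFinD; apply: leeD.
  rewrite jordan_posE cjordan_posE /crestr0/= mem_set// /crestr setTI.
  by apply: le_trans (dist_le _ mP); exact: lee_abs.
rewrite jordan_negE cjordan_negE /crestr0/= mem_set// /crestr setTI.
by apply: le_trans (dist_le _ mN); rewrite -abseN; exact: lee_abs.
Qed.

End TotalVariation.

(** Taking complements turns an upper bound into a lower one. *)
Lemma probability_dist_le (R : realType) d (T : measurableType d)
    (p q : probability T R) (e : R) :
  (forall A, measurable A -> fine (p A) <= fine (q A) + e) ->
  forall A, measurable A -> (`|p A - q A| <= e%:E)%E.
Proof.
move=> pq A mA; have pqA := pq _ mA; have := pq _ (measurableC mA).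
rewrite !probability_setC// !fineB ?fin_num_measure//= => pqC.
rewrite -[p A]fineK ?fin_num_measure// -[q A]fineK ?fin_num_measure//.
by rewrite -EFinB abse_EFin lee_fin ler_norml; apply/andP; split; lra.
Qed.

Lemma bounded_integrable (R : realType) d (T : measurableType d)
    (p : probability T R) (h : T -> R) (K : R) :
  measurable_fun setT h -> (forall x, `|h x| <= K) ->
  p.-integrable setT (EFin \o h).
Proof.
move=> mh hK; apply: measurable_bounded_integrable => //.
  by rewrite /= probability_setT ltry.
exists K; split; first exact: num_real.
by move=> r Kr x _; apply: le_trans (hK x) (ltW Kr).
Qed.

(** * Concentration near the diagonal, tested on sets *)

Definition self_coupling (R : realType) d (X : measurableType d)
    (mu : probability X R) (p : probability (X * X)%type R) : Prop :=
  forall A, measurable A ->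
    pushforward p fst A = mu A /\ pushforward p snd A = mu A.

Section OffDiagonal.
Context (R : realType) d (X : measurableType d) (mu : probability X R).
Variable nu : (probability (X * X)%type R)^nat.
Hypothesis marg : forall n, self_coupling mu (nu n).
Local Open Scope ereal_scope.

(** Measurability is part of the definition so that the sets with this property
    form a sigma-algebra. *)
Definition offdiag_null (A : set X) : Prop := measurable A /\
  vanishes (fun n => nu n (A `*` ~` A)).

Lemma measurable_offdiag (A : set X) : measurable A -> measurable (A `*` ~` A).
Proof. by move=> mA; apply: measurableX => //; exact: measurableC. Qed.

(** Both sides equal mu A - p (A `*` A), because the marginals agree. *)
Lemma offdiag_setC (p : probability (X * X)%type R) A :
  self_coupling mu p -> measurable A -> p (~` A `*` A) = p (A `*` ~` A).
Proof.
move=> pm mA; have mCA := measurableC mA; have [p1 p2] := pm A mA.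
have mAA : measurable (A `*` A) by exact: measurableX.
have E1 : fst @^-1` A = (A `*` A) `|` (A `*` ~` A).
  by apply/seteqP; split=> [[x y] /= Ax|[x y] /= [[]|[]]//];
    case: (pselect (A y)); [left|right].
have E2 : snd @^-1` A = (A `*` A) `|` (~` A `*` A).
  by apply/seteqP; split=> [[x y] /= Ay|[x y] /= [[]|[]]//];
    case: (pselect (A x)); [left|right].
move: p1; rewrite -p2 /pushforward E1 E2 !measureU//; last 4 first.
- exact: measurableX.
- by apply/seteqP; split=> // -[x y] [[/= Ax _]] [].
- exact: measurable_offdiag.
- by apply/seteqP; split=> // -[x y] [[_ /= Ay]] [].
move=> /(congr1 (fun r => r - p (A `*` A))).
by rewrite ![p (A `*` A) + _]addeC !addeK// fin_num_measure.
Qed.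

Lemma offdiag_null_setC A : offdiag_null A -> offdiag_null (~` A).
Proof.
move=> [mA Anull]; split; first exact: measurableC.
move=> e e0; near=> n; rewrite setCK (offdiag_setC (marg n))//.
by near: n; exact: Anull.
Unshelve. all: by end_near. Qed.

(** A pair leaving the union either starts in its tail, which has small mass for
    mu and hence for the first marginal of nu_n, uniformly in n, or leaves one of
    finitely many of the sets. *)
Lemma offdiag_null_bigcup (F : (set X)^nat) :
  (forall k, offdiag_null (F k)) -> offdiag_null (\bigcup_k F k).
Proof.
move=> Fnull; have mF k : measurable (F k) by case: (Fnull k).
have mU : measurable (\bigcup_k F k) by exact: bigcup_measurable.
split=> // e e0.
have e20 : (0 < e / 2)%R by rewrite divr_gt0.
pose S k := \big[setU/set0]_(i < k) F i.
have mS k : measurable (S k) by exact: bigsetU_measurable.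
have /fine_cvgP[_ /cvgrPdist_le /(_ _ e20)[K _ KS]] :
    mu \o S @ \oo --> (fine (mu (\bigcup_k F k)))%:E.
  rewrite fineK ?fin_num_measure//.
  have US : \bigcup_k F k = \bigcup_k S k.
    apply/seteqP; split=> x [k _]; rewrite /S -?bigcup_mkord.
      by exists k.+1 => //; rewrite -bigcup_mkord; exists k => //=.
    by case=> i _ Fix; exists i.
  rewrite US; apply: nondecreasing_cvg_mu => //; first by rewrite -US.
  by move=> i j ij; apply/subsetPset; exact: subset_bigsetU.
have tail : mu (\bigcup_k F k `\` S K) <= (e / 2)%:E.
  rewrite measureD//; last by rewrite ltey_eq fin_num_measure.
  rewrite setIidr; last first.
    by rewrite /S -bigcup_mkord => x [i _ Fix]; exists i.
  have := KS K (leqnn K); rewrite /= => /(le_trans (ler_norm _)).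
  by rewrite -lee_fin EFinB !fineK ?fin_num_measure.
pose O i := F i `*` ~` F i.
near=> n.
have cover : (\bigcup_k F k) `*` ~` (\bigcup_k F k) `<=`
    (fst @^-1` (\bigcup_k F k `\` S K)) `|` \big[setU/set0]_(i < K) O i.
  move=> [x y] [/= Fx Fy]; have [Sx|Sx] := pselect (S K x); last by left.
  right; move: Sx; rewrite /S -bigcup_mkord -bigcup_mkord => -[i iK Fix]; exists i => //.
  by split => // Fiy; apply: Fy; exists i.
have mfst : measurable (fst @^-1` (\bigcup_k F k `\` S K) : set (X * X)).
  by rewrite -[X in measurable X]setTI; apply: measurable_fst => //; exact: measurableD.
have mO : measurable (\big[setU/set0]_(i < K) O i).
  by apply: bigsetU_measurable => i _; exact: measurable_offdiag.
apply: (@le_trans _ _ (nu n ((fst @^-1` (\bigcup_k F k `\` S K)) `|`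
    \big[setU/set0]_(i < K) O i))).
  apply: le_measure => //; rewrite inE; last exact: measurableU.
  exact: measurable_offdiag.
rewrite (splitr e) EFinD; apply: le_trans (measureU2 _ _ _) (leeD _ _) => //.
  have [margE _] := marg n (measurableD mU (mS K)).
  by apply: le_trans tail; rewrite -margE; exact: lexx.
apply: le_trans (Boole_inequality _ _) _.
  by move=> i _; exact: measurable_offdiag.
near: n; apply: (@vanishes_sum _ K (fun i n => nu n (O i))) => //.
by move=> i; case: (Fnull i).
Unshelve. all: by end_near. Qed.

Lemma offdiag_null_sigma_algebra : sigma_algebra setT offdiag_null.
Proof.
split.
- split=> // e e0; near=> n; rewrite set0X measure0 lee_fin; exact: ltW.
- by move=> A /offdiag_null_setC; rewrite setTD.
- exact: offdiag_null_bigcup.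
Unshelve. all: by end_near. Qed.

End OffDiagonal.

(** A countable basis of the topology generates the Borel sets, since every open
    set is a countable union of basic ones. *)
Lemma standard_borel_generators (R : realType) d (X : measurableType d) :
  standard_borel R X ->
  exists B : nat -> set X, (forall k, measurable (B k)) /\
    forall C : set (set X), sigma_algebra setT C -> (forall k, C (B k)) ->
      forall A, measurable A -> C A.
Proof.
move=> [Y [f [_ [B Bcount [Bopen Bnbhs]] [g fK gK] borelE]]].
have [u uB] := countable_enum set0 Bcount.
pose v k := if `[< B (u k) >] then u k else set0.
exists (fun k => f @^-1` v k); split.
  move=> k; apply/borelE; rewrite /v; case: asboolP => [Bu|_].
    by apply: sub_sigma_algebra; exact: Bopen.
  by apply: sub_sigma_algebra; exact: open0.
move=> C [C0 CC CU] Cv A mA.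
have AE : A = f @^-1` (g @^-1` A).
  by apply/seteqP; split=> x /=; rewrite fK.
rewrite AE in mA *; have := (borelE _).2 mA.
suff : <<s open>> `<=` [set D | C (f @^-1` D)] by apply.
apply: smallest_sub.
  split=> /=; first by rewrite preimage_set0.
    by move=> D CD; rewrite setTD preimage_setC -setTD; exact: CC.
  by move=> F CF; rewrite preimage_bigcup; exact: CU.
move=> D oD /=.
have -> : D = \bigcup_k (if `[< v k `<=` D >] then v k else set0).
  apply/seteqP; split=> [y Dy|y [k _]]; last first.
    by case: asboolP => [vD|_ []]; exact: vD.
  have [U [BU Uy] UD] := Bnbhs y D (open_nbhs_nbhs (conj oD Dy)).
  have [k uk] := uB _ BU.
  by exists k => //; rewrite /v uk !asboolT.
rewrite preimage_bigcup; apply: CU => k.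
by case: asboolP => _ //; rewrite preimage_set0.
Qed.

(** * Concentration near the diagonal, tested on functions *)

Section FunctionsToSets.
Context (R : realType) d (X : measurableType d) (mu : probability X R).
Variable nu : (probability (X * X)%type R)^nat.

Lemma Rintegral_indicE d' (T : measurableType d') (p : probability T R) (A : set T) :
  measurable A -> (\int[p]_x \1_A x)%R = fine (p A).
Proof. by move=> mA; rewrite /Rintegral integral_indic// setIT. Qed.

(** Test against the indicators of A and of its complement, whose product
    vanishes on the diagonal. *)
Lemma cvg_Cintegral_offdiag :
  (forall phi psi : X -> R[i]^o,
       borel_complex phi -> bounded_complex phi ->
       borel_complex psi -> bounded_complex psi ->
       Cintegral (nu n) (fun p => phi p.1 * psi p.2) @[n --> \oo]
         --> Cintegral mu (fun x => phi x * psi x)) ->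
  forall A, measurable A -> offdiag_null nu A.
Proof.
move=> cvgC A mA; split=> // e e0.
pose ind (B : set X) (x : X) : R[i]^o := ((\1_B x)%:C)%C.
have borel_ind B : measurable B -> borel_complex (ind B).
  move=> mB U _.
  have -> : ind B @^-1` U = (if `[< U 1%C >] then B else set0) `|`
      (if `[< U 0%C >] then ~` B else set0).
    apply/seteqP; split=> x; rewrite /ind /= indicE.
      have [|] := boolP (x \in B); rewrite ?inE ?notin_setE => Bx /= Ux.
        by left; case: asboolP.
      by right; case: asboolP.
    by case=> [] ; case: asboolP => //= Ux Bx; [rewrite mem_set|rewrite memNset].
  by apply: measurableU; case: asboolP => // _; exact: measurableC.
have bounded_ind B : bounded_complex (ind B).
  exists 1 => x; rewrite /ind indicE; case: (x \in B).
    by rewrite normr1.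
  by rewrite normr0 ler01.
have := cvgC (ind A) (ind (~` A)) (borel_ind _ mA) (bounded_ind _)
  (borel_ind _ (measurableC mA)) (bounded_ind _).
have -> : Cintegral mu (fun x => ind A x * ind (~` A) x) = 0.
  rewrite /Cintegral.
  have E x : ind A x * ind (~` A) x = 0.
    rewrite /ind !indicE in_setC; case: (x \in A); by rewrite ?mulr0 ?mul0r.
  under eq_Rintegral do rewrite E/=.
  under [X in (_ +i* X)%C]eq_Rintegral do rewrite E/=.
  by rewrite Rintegral_cst// mul0r.
have IE n : Cintegral (nu n) (fun p => ind A p.1 * ind (~` A) p.2)
    = ((fine (nu n (A `*` ~` A)))%:C)%C.
  have E p : ind A p.1 * ind (~` A) p.2 = ((\1_(A `*` ~` A) p)%:C)%C.
    rewrite /ind !indicE in_setX -rmorphM/= in_setC; case: (p.1 \in A); case: (p.2 \in A);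
     by rewrite /= ?mulr0 ?mul0r ?mulr1.
  rewrite /Cintegral; congr (_ +i* _)%C.
    under eq_Rintegral do rewrite E/=.
    by rewrite Rintegral_indicE//; exact: measurable_offdiag.
  under eq_Rintegral do rewrite E/=.
  by rewrite Rintegral_cst// mul0r.
move=> /cvgrPdist_le /(_ (e%:C)%C) dist_small.
near=> n.
have : `|0 - Cintegral (nu n) (fun p => ind A p.1 * ind (~` A) p.2)| <= (e%:C)%C.
  by near: n; apply: dist_small; rewrite ltcR.
rewrite IE sub0r normrN ger0_norm; last by rewrite lecR fine_ge0.
by rewrite lecR -lee_fin fineK// fin_num_measure//; exact: measurable_offdiag.
Unshelve. all: by end_near. Qed.

End FunctionsToSets.

Section RealSetsToFunctions.
Context (R : realType) d (X : measurableType d) (mu : probability X R).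
Variable nu : (probability (X * X)%type R)^nat.
Hypothesis marg : forall n, self_coupling mu (nu n).
Hypothesis nu_null : forall A, measurable A -> offdiag_null nu A.

(** Cut the range of f into finitely many intervals of length e.  If f moves by at
    least e between the two coordinates, the pair leaves the preimage of the
    interval of its first coordinate. *)
Lemma vanishes_dist (f : X -> R) (M e : R) :
  measurable_fun setT f -> (forall x, `|f x| <= M) -> 0 < e ->
  vanishes (fun n => nu n [set p | e <= `|f p.2 - f p.1|]).
Proof.
move=> mf fM e0.
pose A j := f @^-1` `[- M + j%:R * e, - M + j.+1%:R * e[%classic.
have mA j : measurable (A j) by rewrite -[A j]setTI; exact: mf.
pose O j := A j `*` ~` A j.
have mO j : measurable (O j) by exact: measurable_offdiag.
pose J := (Num.truncn ((M + M) / e)).+1.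
apply: (@le_vanishes _ _ (fun n => \sum_(j < J) nu n (O j))%E) => [n|]; last first.
  by apply: (@vanishes_sum _ J (fun j n => nu n (O j))) => j; case: (nu_null (mA j)).
apply: le_trans (Boole_inequality _ _) => //; apply: le_measure.
- rewrite inE -[X in measurable X]setTI.
  have mdist : measurable_fun setT (fun p : X * X => `|f p.2 - f p.1|).
    apply: measurableT_comp => //; apply: measurable_funB.
      exact: measurableT_comp.
    exact: measurableT_comp.
  rewrite (_ : [set p | _] = (fun p : X * X => `|f p.2 - f p.1|) @^-1` `[e, +oo[%classic).
    exact: mdist.
  by apply/seteqP; split=> p /=; rewrite in_itv/= andbT.
- by rewrite inE; apply: bigsetU_measurable.
move=> [x y] /= exy; rewrite -bigcup_mkord.
have fx0 : 0 <= (f x + M) / e.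
  by rewrite divr_ge0 ?(ltW e0)//; have := fM x; rewrite ler_norml; lra.
have /andP[] := truncn_itv fx0; set j := Num.truncn _.
rewrite ler_pdivlMr// ltr_pdivrMr// => lej ltj.
have Ajx : A j x by rewrite /A/= in_itv/=; apply/andP; split; lra.
exists j.
  rewrite /= /J ltnS; apply: le_truncn.
  by rewrite ler_pM2r ?invr_gt0// lerD2r; exact: le_trans (ler_norm _) (fM x).
split=> //; rewrite /A/= in_itv/= => /andP[ley lty].
move: exy; rewrite leNgt => /negP; apply.
move: ltj lty; rewrite -natr1 mulrDl mul1r => ltj lty.
by rewrite ltr_norml; apply/andP; split; lra.
Qed.

Lemma Rintegral_fst (h : X -> R) n (K : R) :
  measurable_fun setT h -> (forall x, `|h x| <= K) ->
  \int[nu n]_p h p.1 = \int[mu]_x h x.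
Proof.
move=> mh hK; rewrite /Rintegral; congr fine.
have -> : (\int[mu]_x (h x)%:E = \int[pushforward (nu n) fst]_x (h x)%:E)%E.
  by apply: eq_measure_integral => A mA _; case: (marg n mA).
rewrite integral_pushforward//; first exact/measurable_EFinP.
apply: (@bounded_integrable _ _ _ _ (h \o fst) K) => // [|x]; last exact: hK.
exact: measurableT_comp.
Qed.

(** By the first marginal, the limit is the integral of f(x) g(x) against nu_n.
    Its difference with the integral of f(x) g(y) is at most M eta where
    |g(y) - g(x)| < eta, and 2 M^2 on the remaining set, which is asymptotically
    null. *)
Lemma cvg_Rintegral_product (f g : X -> R) (M : R) : 0 < M ->
  measurable_fun setT f -> measurable_fun setT g ->
  (forall x, `|f x| <= M) -> (forall x, `|g x| <= M) ->
  \int[nu n]_p (f p.1 * g p.2) @[n --> \oo] --> \int[mu]_x (f x * g x).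
Proof.
move=> M0 mf mg fM gM; apply/cvgrPdist_le => e e0.
(* M * eta = e / 4, and the rest contributes at most 2 M^2 * e / (4 M^2) = e / 2 *)
pose eta := e / (M + M) / 2.
have eta0 : 0 < eta by rewrite !divr_gt0// addr_gt0.
pose D := [set p : X * X | eta <= `|g p.2 - g p.1|].
have mf1 : measurable_fun setT (fun p : X * X => f p.1) by exact: measurableT_comp.
have mg1 : measurable_fun setT (fun p : X * X => g p.1) by exact: measurableT_comp.
have mg2 : measurable_fun setT (fun p : X * X => g p.2) by exact: measurableT_comp.
have mdist : measurable_fun setT (fun p : X * X => `|g p.2 - g p.1|).
  by apply: measurableT_comp => //; exact: measurable_funB.
have mD : measurable D.
  rewrite -[D]setTI (_ : D = (fun p : X * X => `|g p.2 - g p.1|) @^-1` `[eta, +oo[%classic).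
    exact: mdist.
  by apply/seteqP; split=> p /=; rewrite in_itv/= andbT.
have fgM x y : `|f x * g y| <= M * M by rewrite normrM ler_pM.
have MM0 : 0 <= M * (M + M) by rewrite mulr_ge0 ?addr_ge0 ?ltW.
have Meta0 : 0 <= M * eta by rewrite mulr_ge0 ?ltW.
have ind_ge0 p : 0 <= \1_D p :> R by rewrite indicE ler0n.
have ind_le1 p : \1_D p <= 1 :> R by rewrite indicE lern1 leq_b1.
near=> n.
have nuD : fine (nu n D) <= e / (M * M * 4).
  rewrite -lee_fin fineK ?fin_num_measure//.
  by near: n; apply: (vanishes_dist mg gM eta0); rewrite divr_gt0// !mulr_gt0.
rewrite -(@Rintegral_fst (fun x => f x * g x) n (M * M)); last 2 first.
- exact: measurable_funM.
- by move=> x.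
have int1 : (nu n).-integrable setT (EFin \o fun p => f p.1 * g p.1).
  by apply: (@bounded_integrable _ _ _ _ _ (M * M)) => //; exact: measurable_funM.
have int2 : (nu n).-integrable setT (EFin \o fun p => f p.1 * g p.2).
  by apply: (@bounded_integrable _ _ _ _ _ (M * M)) => //; exact: measurable_funM.
rewrite -RintegralB//.
have intB : (nu n).-integrable setT (EFin \o fun p => f p.1 * g p.1 - f p.1 * g p.2).
  exact: integrableB int1 int2.
apply: le_trans (le_normr_Rintegral _ intB) _ => //.
have intD : (nu n).-integrable setT (EFin \o fun p => M * eta + M * (M + M) * \1_D p).
  apply: (@bounded_integrable _ _ _ _ _ (M * eta + M * (M + M))) => [|p].
    apply: measurable_funD => //; apply: measurable_funM => //.
  rewrite ger0_norm; last first.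
    by rewrite addr_ge0// mulr_ge0// ind_ge0.
  by rewrite lerD2l ler_piMr// ind_le1.
apply: (@le_trans _ _ (\int[nu n]_p (M * eta + M * (M + M) * \1_D p))).
  apply: le_Rintegral => //.
    apply: (@bounded_integrable _ _ _ _ _ (M * M + M * M)) => [|p].
      apply: measurableT_comp => //; apply: measurable_funB; exact: measurable_funM.
    by rewrite normr_id (le_trans (ler_normB _ _))// lerD.
  move=> p _; rewrite -mulrBr normrM distrC.
  have [Dp|Dp] := boolP (p \in D).
    rewrite indicE Dp mulr1.
    apply: (@le_trans _ _ (M * (M + M))).
      by rewrite ler_pM// (le_trans (ler_normB _ _))// lerD.
    by rewrite lerDr.
  rewrite indicE (negbTE Dp) mulr0 addr0 ler_pM//.
  move: Dp; rewrite notin_setE /D/= => /negP; rewrite -ltNge; exact: ltW.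
rewrite RintegralD//; last 2 first.
- by apply: (@bounded_integrable _ _ _ _ _ (`|M * eta|)) => //.
- apply: (@bounded_integrable _ _ _ _ _ (M * (M + M))) => [|p].
    by apply: measurable_funM => //; exact: measurable_indic.
  by rewrite normrM !ger0_norm ?ind_ge0// ler_piMr// ind_le1.
have nu1 : fine (nu n setT) = 1 by rewrite probability_setT.
rewrite Rintegral_cst// nu1 mulr1 RintegralZl//; last first.
  apply: (@bounded_integrable _ _ _ _ _ 1) => [|p]; first exact: measurable_indic.
  by rewrite ger0_norm ?ind_ge0 ?ind_le1.
rewrite Rintegral_indicE//.
have -> : M * eta = e / 4 by rewrite /eta; field; rewrite gt_eqF// addr_gt0.
have : M * (M + M) * fine (nu n D) <= M * (M + M) * (e / (M * M * 4)).
  exact: ler_wpM2l.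
have -> : M * (M + M) * (e / (M * M * 4)) = e / 2 by field; rewrite gt_eqF.
lra.
Unshelve. all: by end_near. Qed.

End RealSetsToFunctions.

Section ComplexCondition.
Context (R : realType) d (X : measurableType d).

Lemma ler_Re_norm (z : R[i]) (M : R) : `|z| <= (M%:C)%C -> `|complex.Re z| <= M.
Proof. by move=> /(le_trans (normc_ge_Re z)); rewrite lecR. Qed.

Lemma normC_ge_Im (z : R[i]) : (`|complex.Im z|%:C)%C <= `|z|.
Proof.
by case: z => a b; simpc; rewrite -sqrtr_sqr ler_wsqrtr // lerDr sqr_ge0.
Qed.

Lemma ler_Im_norm (z : R[i]) (M : R) : `|z| <= (M%:C)%C -> `|complex.Im z| <= M.
Proof. by move=> /(le_trans (normC_ge_Im z)); rewrite lecR. Qed.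

(** Applied to the real and imaginary parts, which are 1-Lipschitz. *)
Lemma measurable_component (f : R[i] -> R) (phi : X -> R[i]^o) :
  (forall z w, (`|f z - f w|%:C)%C <= `|z - w|) ->
  borel_complex phi -> measurable_fun setT (f \o phi).
Proof.
move=> fle mphi.
apply: (measurability _ (RGenOInfty.measurableE R)) => _ [_ [r ->] <-].
rewrite setTI comp_preimage; apply: mphi.
rewrite openE => z /=; rewrite in_itv/= andbT => rz.
apply/nbhs_ballP; exists ((f z - r)%:C)%C; first by rewrite /= ltcR subr_gt0.
move=> w; rewrite -ball_normE /ball_/= => zw.
have := le_lt_trans (fle z w) zw.
rewrite ltcR in_itv/= andbT ltr_norml; lra.
Qed.

Lemma cvg_complex (u v : nat -> R) (a b : R) :
  u @ \oo --> a -> v @ \oo --> b ->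
  ((u n +i* v n)%C : R[i]^o) @[n --> \oo] --> ((a +i* b)%C : R[i]^o).
Proof.
move=> ua vb; apply/cvgrPdist_le => -[e e'] /=; rewrite ltcE/= => /andP[/eqP -> e0].
have e20 : 0 < e / 2 by rewrite divr_gt0.
near=> n.
have ue : `|a - u n| <= e / 2 by near: n; move/cvgrPdist_le : ua; exact.
have ve : `|b - v n| <= e / 2 by near: n; move/cvgrPdist_le : vb; exact.
rewrite normc_def/= lecR.
rewrite -(ger0_norm (ltW e0)) -sqrtr_sqr ler_sqrt; last by rewrite sqr_ge0.
move: ue ve; rewrite !ler_norml => /andP[? ?] /andP[? ?]; nra.
Unshelve. all: by end_near. Qed.

End ComplexCondition.

Section SetsToFunctions.
Context (R : realType) d (X : measurableType d) (mu : probability X R).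
Variable nu : (probability (X * X)%type R)^nat.
Hypothesis marg : forall n, self_coupling mu (nu n).
Hypothesis nu_null : forall A, measurable A -> offdiag_null nu A.

(** The real and imaginary parts of phi(x) psi(y) are sums of two products of
    real functions of the separate variables. *)
Lemma offdiag_null_cvg_Cintegral (phi psi : X -> R[i]^o) :
  borel_complex phi -> bounded_complex phi ->
  borel_complex psi -> bounded_complex psi ->
  Cintegral (nu n) (fun p => phi p.1 * psi p.2) @[n --> \oo]
    --> Cintegral mu (fun x => phi x * psi x).
Proof.
move=> bphi [K phiK] bpsi [K' psiK'].
pose M := `|K| + `|K'| + 1.
have M0 : 0 < M by rewrite ltr_wpDl// addr_ge0.
have phiM x : `|phi x| <= (M%:C)%C.
  by apply: le_trans (phiK x) _; rewrite lecR /M;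
    have := ler_norm K; have := normr_ge0 K'; lra.
have psiM x : `|psi x| <= (M%:C)%C.
  by apply: le_trans (psiK' x) _; rewrite lecR /M;
    have := ler_norm K'; have := normr_ge0 K; lra.
have dRe (z w : R[i]) : (`|complex.Re z - complex.Re w|%:C)%C <= `|z - w|.
  by have := normc_ge_Re (z - w); rewrite raddfB.
have dIm (z w : R[i]) : (`|complex.Im z - complex.Im w|%:C)%C <= `|z - w|.
  by have := normC_ge_Im (z - w); rewrite raddfB.
pose f := (@complex.Re R : R[i] -> R) \o phi.
pose f' := (@complex.Im R : R[i] -> R) \o phi.
pose g := (@complex.Re R : R[i] -> R) \o psi.
pose g' := (@complex.Im R : R[i] -> R) \o psi.
have mf : measurable_fun setT f := measurable_component dRe bphi.
have mf' : measurable_fun setT f' := measurable_component dIm bphi.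
have mg : measurable_fun setT g := measurable_component dRe bpsi.
have mg' : measurable_fun setT g' := measurable_component dIm bpsi.
have fM x : `|f x| <= M := ler_Re_norm (phiM x).
have f'M x : `|f' x| <= M := ler_Im_norm (phiM x).
have gM x : `|g x| <= M := ler_Re_norm (psiM x).
have g'M x : `|g' x| <= M := ler_Im_norm (psiM x).
have ReM (z w : R[i]) : complex.Re (z * w)
  = complex.Re z * complex.Re w - complex.Im z * complex.Im w by case: z; case: w.
have ImM (z w : R[i]) : complex.Im (z * w)
  = complex.Re z * complex.Im w + complex.Im z * complex.Re w by case: z; case: w.
have intX (a b : X -> R) n : measurable_fun setT a -> measurable_fun setT b ->
    (forall x, `|a x| <= M) -> (forall x, `|b x| <= M) ->
    (nu n).-integrable setT (EFin \o fun p => a p.1 * b p.2).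
  move=> ma mb aM bM; apply: (@bounded_integrable _ _ _ _ _ (M * M)) => [|p].
    by apply: measurable_funM; exact: measurableT_comp.
  by rewrite normrM ler_pM.
have intx (a b : X -> R) : measurable_fun setT a -> measurable_fun setT b ->
    (forall x, `|a x| <= M) -> (forall x, `|b x| <= M) ->
    mu.-integrable setT (EFin \o fun x => a x * b x).
  move=> ma mb aM bM; apply: (@bounded_integrable _ _ _ _ _ (M * M)) => [|p].
    exact: measurable_funM.
  by rewrite normrM ler_pM.
have ReE n : \int[nu n]_p complex.Re (phi p.1 * psi p.2) =
    \int[nu n]_p (f p.1 * g p.2) - \int[nu n]_p (f' p.1 * g' p.2).
  under eq_Rintegral do rewrite ReM.
  exact: (RintegralB measurableT (intX f g n mf mg fM gM) (intX f' g' n mf' mg' f'M g'M)).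
have ImE n : \int[nu n]_p complex.Im (phi p.1 * psi p.2) =
    \int[nu n]_p (f p.1 * g' p.2) + \int[nu n]_p (f' p.1 * g p.2).
  under eq_Rintegral do rewrite ImM.
  exact: (RintegralD measurableT (intX f g' n mf mg' fM g'M) (intX f' g n mf' mg f'M gM)).
have ReE0 : \int[mu]_x complex.Re (phi x * psi x) =
    \int[mu]_x (f x * g x) - \int[mu]_x (f' x * g' x).
  under eq_Rintegral do rewrite ReM.
  exact: (RintegralB measurableT (intx f g mf mg fM gM) (intx f' g' mf' mg' f'M g'M)).
have ImE0 : \int[mu]_x complex.Im (phi x * psi x) =
    \int[mu]_x (f x * g' x) + \int[mu]_x (f' x * g x).
  under eq_Rintegral do rewrite ImM.
  exact: (RintegralD measurableT (intx f g' mf mg' fM g'M) (intx f' g mf' mg f'M gM)).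
rewrite /Cintegral ReE0 ImE0; apply: cvg_complex.
  by rewrite (eq_cvg _ _ ReE); apply: cvgB;
    exact: (cvg_Rintegral_product marg nu_null M0).
by rewrite (eq_cvg _ _ ImE); apply: cvgD;
  exact: (cvg_Rintegral_product marg nu_null M0).
Qed.

End SetsToFunctions.

(** * Averaging over cosets *)

Lemma mnormalize_mass1 (R : realType) d (T : measurableType d)
    (m : {measure set T -> \bar R}) (p : probability T R) :
  m setT = 1%E -> mnormalize m p = m.
Proof.
move=> m1; apply: funext => A.
by rewrite /mnormalize m1 onee_eq0/= invr1 mule1.
Qed.

Section ProductAction.
Context (R : realType) d (X : measurableType d) (mu : probability X R).
Context (G : groupType) (a : pmp_action mu G).
Local Notation pm g := (product_map (a g)).

Lemma product_mapM g h A : pm h @^-1` (pm g @^-1` A) = pm (g * h)%g @^-1` A.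
Proof.
by apply/seteqP; split=> -[x y]; rewrite /= /product_map/= !actM.
Qed.

Lemma act_inj g : injective (a g).
Proof.
move=> x y /(congr1 (a g^-1%g)).
by rewrite -!actM mulVg !act1.
Qed.

Lemma measurable_act g (A : set X) : measurable A -> measurable (a g @^-1` A).
Proof. by move=> mA; rewrite -[X in measurable X]setTI; exact: measurable_funP. Qed.

Lemma measurable_product_map g (A : set (X * X)) :
  measurable A -> measurable (pm g @^-1` A).
Proof. by move=> mA; rewrite -[X in measurable X]setTI; exact: measurable_funP. Qed.

End ProductAction.

Section Average.
Context (R : realType) d (X : measurableType d) (mu : probability X R).
Context (G : groupType) (a : pmp_action mu G).
Variables (N : nat) (c : nat -> {nonneg R}) (s : nat -> G).
Local Notation pm g := (product_map (a g)).

(** The total mass of the sum is 1 for the weights in use; normalizing makes it a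
    probability by construction, with p as the value in the degenerate case. *)
Definition average (p : probability (X * X)%type R) : probability (X * X)%type R :=
  mnormalize (msum (fun i => mscale (c i) (distribution p (pm (s i)))) N) p.

Hypothesis c1 : \sum_(i < N) (c i)%:num = 1.
Implicit Type p : probability (X * X)%type R.

Lemma averageE p A : average p A =
  (\sum_(i < N) (c i)%:num%:E * p (pm (s i) @^-1` A))%E.
Proof.
have massE : msum (fun i => mscale (c i) (distribution p (pm (s i)))) N setT = 1%E.
  rewrite /msum (eq_bigr (fun i : 'I_N => (c i)%:num%:E)) => [|i _].
    by rewrite sumEFin c1.
  by rewrite -[RHS]mule1; congr *%E; exact: probability_setT.
exact: (congr1 (@^~ A) (mnormalize_mass1 p massE)).
Qed.

Lemma fine_averageE p A : measurable A -> fine (average p A) =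
  \sum_(i < N) (c i)%:num * fine (p (pm (s i) @^-1` A)).
Proof.
move=> mA; rewrite averageE (eq_bigr (fun i : 'I_N =>
    ((c i)%:num * fine (p (pm (s i) @^-1` A)))%:E)) => [|i _].
  by rewrite sumEFin.
rewrite EFinM fineK// fin_num_measure//; exact: measurable_product_map.
Qed.

Lemma average_const p A (r : \bar R) : (0 <= r)%E ->
  (forall g, p (pm g @^-1` A) = r) -> average p A = r.
Proof.
move=> r0 pA; rewrite averageE; under eq_bigr do rewrite pA.
by rewrite -ge0_sume_distrl// sumEFin c1 mul1e.
Qed.

(** Each map x |-> g x is injective, so the diagonal is its own preimage. *)
Lemma average_diagonal p :
  average p [set q | q.1 = q.2] = p [set q | q.1 = q.2].
Proof.
apply: average_const => // g; congr (p _).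
apply/seteqP; split=> -[x y] /=; last by move=> ->.
exact: act_inj.
Qed.

Lemma average_self_coupling p :
  self_coupling mu p -> self_coupling mu (average p).
Proof.
move=> marg A mA; split; apply: average_const => // g.
  by rewrite -(act_preserves a g mA); have [<- _] := marg _ (measurable_act a g mA).
by rewrite -(act_preserves a g mA); have [_ <-] := marg _ (measurable_act a g mA).
Qed.

(** The preimage of A `*` ~` A under an element of G has the same form. *)
Lemma average_vanishes (nu : (probability (X * X)%type R)^nat) :
  (forall A, measurable A -> vanishes (fun n => nu n (A `*` ~` A))) ->
  forall A, measurable A -> vanishes (fun n => average (nu n) (A `*` ~` A)).
Proof.
move=> nu0 A mA; pose B i := a (s i) @^-1` A.
apply: (@le_vanishes _ _ (fun n => \sum_(i < N) nu n (B i `*` ~` B i))%E).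
  move=> n; rewrite averageE//; apply: lee_sum => i _.
  rewrite -[leRHS]mul1e; apply: lee_wpmul2r; first exact: measure_ge0.
  by rewrite lee_fin -c1 (bigD1 i)//= lerDl sumr_ge0.
apply: (@vanishes_sum _ _ (fun i n => nu n (B i `*` ~` B i))) => i.
exact/nu0/measurable_act.
Qed.

End Average.

Section AlmostInvariant.
Local Notation coset L g := (translate g (range (val : L -> _))).
Context (R : realType) d (X : measurableType d) (mu : probability X R).
Context (G : groupType) (P : pred G) (L : subGroupType P) (a : pmp_action mu G).
Local Notation pm g := (product_map (a g)).
Variables (N : nat) (c : nat -> {nonneg R}) (s : nat -> G) (S : seq G) (e : R).
Hypothesis folner : folner_weights L S e N c s.
Variable nu : (probability (X * X)%type R)^nat.
Hypothesis nu_inv : forall l : L,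
       total_variation_norm
         (measure_diff (distribution (nu n) (product_map (restrict_action L a l))) (nu n))
         @[n --> \oo] --> 0%E.

(** Here t = h l with l in L, and moving nu_n by l before moving it by h costs an
    error that is uniform over all measurable sets. *)
Lemma near_coset_indep (h t : G) (delta : R) : 0 < delta ->
  coset L t = coset L h -> \forall n \near \oo, forall A, measurable A ->
  `|fine (nu n (pm t @^-1` A)) - fine (nu n (pm h @^-1` A))| <= delta.
Proof.
move=> delta0 th.
have [l tE] : exists l : L, t = (h * val l)%g.
  have : coset L t t by exists 1%g; [exists 1%g => //; rewrite val1|rewrite mulg1].
  by rewrite th => -[_ [l _ <-] <-]; exists l.
have := cvg0_vanishes (nu_inv l) delta0; apply: filterS => n tv_small A mA.
have mhA := measurable_product_map a h mA.
have mtA := measurable_product_map a t mA.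
have tv : (`|nu n (pm t @^-1` A) - nu n (pm h @^-1` A)| <=
    total_variation_norm (measure_diff
      (distribution (nu n) (product_map (restrict_action L a l))) (nu n)))%E.
  by rewrite tE -product_mapM; exact: (le_total_variation_norm
    (distribution (nu n) (product_map (restrict_action L a l))) (nu n) mhA).
rewrite -lee_fin; apply: le_trans tv_small; apply: le_trans tv.
by rewrite -abse_EFin EFinB !fineK ?fin_num_measure.
Qed.

(** Let u(C) be the mass of A for nu_n translated by a fixed representative of the
    coset C.  Replacing the translating elements by these representatives costs
    delta before and after translation by g; between the two, the weights are
    tested on u. *)
Lemma near_average_invariant (delta : R) : 0 < delta ->
  \forall n \near \oo, forall g A, g \in S -> measurable A ->
    fine (average a N c s (nu n) (pm g @^-1` A))
      <= fine (average a N c s (nu n) A) + e + delta + delta.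
Proof.
move=> delta0; have [c1 folner_le] := folner.
have [sec secE] : {sec : set G -> G | forall h, coset L (sec (coset L h)) = coset L h}.
  exists (fun C => xget 1%g [set h | coset L h = C]) => h.
  by case: xgetP => [x _ //|/(_ h)/(_ erefl)].
(* the elements compared with the representatives of their cosets *)
pose hs := [seq s i | i <- iota 0 N] ++ [seq (g * s i)%g | g <- S, i <- iota 0 N].
have : \forall n \near \oo, forall h, h \in hs -> forall A, measurable A ->
  `|fine (nu n (pm (sec (coset L h)) @^-1` A)) - fine (nu n (pm h @^-1` A))| <= delta.
  by apply: near_all_seq => h _; apply: near_coset_indep.
apply: filterS => n close g A gS mA.
pose u C := fine (nu n (pm (sec C) @^-1` A)).
have u01 C : 0 <= u C <= 1.
  rewrite /u fine_ge0//= -lee_fin fineK ?fin_num_measure ?probability_le1//;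
  exact: measurable_product_map.
rewrite !fine_averageE//; last exact: measurable_product_map.
have sumc b : \sum_(i < N) (c i)%:num * b = b by rewrite -mulr_suml c1 mul1r.
have close1 (i : 'I_N) : u (coset L (s i)) <= fine (nu n (pm (s i) @^-1` A)) + delta.
  have /close/(_ _ mA) : s i \in hs.
    by rewrite mem_cat; apply/orP; left; apply: map_f; rewrite mem_iota add0n ltn_ord.
  by rewrite ler_norml => /andP[_]; rewrite lerBlDl.
have close2 (i : 'I_N) :
    fine (nu n (pm (s i) @^-1` (pm g @^-1` A))) <= u (coset L (g * s i)%g) + delta.
  have /close/(_ _ mA) : (g * s i)%g \in hs.
    by rewrite mem_cat; apply/orP; right; apply: allpairs_f => //;
      rewrite mem_iota add0n ltn_ord.
  by rewrite ler_norml product_mapM /u => /andP[+ _]; lra.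
apply: (@le_trans _ _ (\sum_(i < N) (c i)%:num * (u (coset L (g * s i)%g) + delta))).
  by apply: ler_sum => i _; exact: ler_wpM2l.
under eq_bigr do rewrite mulrDr.
rewrite big_split/= sumc lerD2r.
apply: le_trans (folner_le _ _ gS u01) _; rewrite [leRHS]addrAC lerD2r.
rewrite -[in leRHS](sumc delta) -big_split/=.
by apply: ler_sum => i _; rewrite -mulrDr; exact: ler_wpM2l.
Qed.

End AlmostInvariant.

(** * Rigidity *)

Section Rigid.
Context (R : realType) d (X : measurableType d) (mu : probability X R).
Context (G : groupType) (P : pred G) (L : subGroupType P) (a : pmp_action mu G).

Lemma rigid_restrict_rigid : rigid (restrict_action L a) -> rigid a.
Proof.
move=> rigidL nu nu_marg nu_conc nu_inv.
by apply: rigidL => // l; exact: nu_inv.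
Qed.

(** The k-th average is tested on the first k generators of the sigma-algebra and
    the first k elements of G; at time n the average of index kappa n is used. *)
Lemma rigid_rigid_restrict :
  countable [set: G] -> coamenable L R -> standard_borel R X ->
  rigid a -> rigid (restrict_action L a).
Proof.
move=> Gcount Lco /standard_borel_generators[B [mB Bgen]] rigida nu marg conc inv.
have [gk gkP] := countable_enum 1%g Gcount.
pose eps k : R := k.+1%:R^-1.
have eps0 k : 0 < eps k by rewrite invr_gt0.
have {Lco} [w wP] : {w : nat -> nat * (nat -> {nonneg R}) * (nat -> G) |
    forall k, folner_weights L [seq gk i | i <- iota 0 k] (eps k)
      (w k).1.1 (w k).1.2 (w k).2}.
  suff wk k : {v : nat * (nat -> {nonneg R}) * (nat -> G) |
      folner_weights L [seq gk i | i <- iota 0 k] (eps k) v.1.1 v.1.2 v.2}.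
    by exists (fun k => sval (wk k)) => k; exact: (svalP (wk k)).
  apply: cid; have [N [c [s cs]]] :=
    folner_weights_exist [seq gk i | i <- iota 0 k] Lco (eps0 k).
  by exists (N, c, s).
pose avg k n := average a (w k).1.1 (w k).1.2 (w k).2 (nu n).
have wc k : \sum_(i < (w k).1.1) ((w k).1.2 i)%:num = 1 by case: (wP k).
pose Q k n := (forall i, i \in iota 0 k ->
    (avg k n (B i `*` ~` B i) <= (eps k)%:E)%E) /\
  (forall g A, g \in [seq gk i | i <- iota 0 k] -> measurable A ->
    fine (avg k n (product_map (a g) @^-1` A))
      <= fine (avg k n A) + eps k + eps k + eps k).
have nu0 A : measurable A -> vanishes (fun n => nu n (A `*` ~` A)).
  by move=> mA; case: (cvg_Cintegral_offdiag conc mA).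
have Qnear k : \forall n \near \oo, Q k n.
  have Q1 : \forall n \near \oo, forall i, i \in iota 0 k ->
      (avg k n (B i `*` ~` B i) <= (eps k)%:E)%E.
    by apply: near_all_seq => i _; exact: average_vanishes.
  have Q2 := near_average_invariant (wP k) inv (eps0 k).
  by near=> n; split; near: n.
have [kappa kappaP] := diagonal_choice Qnear.
have eps_lt e : 0 < e -> exists k0, forall k, (k0 <= k)%N -> eps k <= e.
  move=> e0; exists (Num.truncn e^-1) => k k0k.
  rewrite /eps -[leRHS]invrK lef_pV2 ?posrE ?invr_gt0//.
  apply: ltW; apply: lt_le_trans (_ : (Num.truncn e^-1).+1%:R <= _).
    by rewrite truncnS_gt.
  by rewrite ler_nat ltnS.
pose nu' n := avg (kappa n) n.
have marg' n : self_coupling mu (nu' n).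
  exact: average_self_coupling (wc _) _ (marg n).
have null' A : measurable A -> offdiag_null nu' A.
  move=> mA; apply: Bgen mA; first exact: offdiag_null_sigma_algebra marg'.
  move=> i; split=> // e e0.
  have [k0 k0e] := eps_lt e e0.
  have := kappaP (maxn k0 i.+1); apply: filterS => n [].
  rewrite geq_max => /andP[k0n ikn] [+ _] => /(_ i); rewrite mem_iota add0n ikn.
  move=> /(_ isT) /le_trans; apply.
  by rewrite lee_fin k0e.
have inv' g : total_variation_norm
    (measure_diff (distribution (nu' n) (product_map (a g))) (nu' n))
    @[n --> \oo] --> 0%E.
  have [j <-] := gkP g I.
  apply: vanishes_cvg0 => [n|].
    exact: le_trans (le_total_variation_norm _ _ measurable0).
  (* the error 3 * eps on sets counts twice in total variation *)
  move=> e e0; have [k0 k0e] := eps_lt (e / 6) (divr_gt0 e0 (ltr0Sn _ _)).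
  have := kappaP (maxn k0 j.+1); apply: filterS => n [].
  rewrite geq_max => /andP[k0n jkn] [_ invn].
  have gS : gk j \in [seq gk i | i <- iota 0 (kappa n)].
    by rewrite map_f// mem_iota add0n.
  apply: le_trans (total_variation_norm_le (e := 3 * eps (kappa n)) _) _.
    apply: probability_dist_le => A mA; apply: le_trans (invn _ _ gS mA) _.
    by rewrite /nu'; lra.
  by rewrite lee_fin; have := k0e _ k0n; lra.
have := rigida nu' marg' (offdiag_null_cvg_Cintegral marg' null') inv'.
by under eq_fun do rewrite average_diagonal//.
Unshelve. all: by end_near. Qed.

End Rigid.

Theorem proposition1p1 (R : realType)
    (G : groupType) (G_countable : countable [set: G])
    (P : pred G) (L : subGroupType P) (L_coamenable : coamenable L R)
    (d : measure_display) (X : measurableType d) (X_standard : standard_borel R X)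
    (mu : probability X R) (a : pmp_action mu G) :
  rigid a <-> rigid (restrict_action L a).
Proof.
split; first exact: rigid_rigid_restrict.
exact: rigid_restrict_rigid.
Qed.
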